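(* Let $\alpha>0$ and let $f$ be a (measurable) slice function on $\mathbb H$ such that $$\int_{\mathbb C_I}|K_\alpha(z,a)|^2\,|f(z)|\,d\lambda_{\alpha,I}(z)<\infty\qquad\text{for all }a\in\mathbb C_I,\ I\in\mathbb S.$$ Then the slice-wise formula $$(B_\alpha f)(z):=\int_{\mathbb C_I}|k_z(w)|^2f(w)\,d\lambda_{\alpha,I}(w)=\frac{\alpha}{\pi}\int_{\mathbb C_I}e^{-\alpha|w-z|^2}f(w)\,dm_{2,I}(w),\qquad z\in\mathbb C_I,\ I\in\mathbb S,$$ defines a slice function $B_\alpha f$ on $\mathbb H$. Moreover, if on $\mathbb C_I$ one writes $f|_{\mathbb C_I}=F+GJ$ with $J\in\mathbb S$, $J\perp I$, and $F,G:\mathbb C_I\to\mathbb C_I$, then $$(B_\alpha f)(z)=B_{\alpha,I}F(z)+B_{\alpha,I}G(z)\,J,\qquad z\in\mathbb C_I.$$ In particular, if $f$ is slice intrinsic, then $B_\alpha f$ is slice intrinsic.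
   Context: $\mathbb H$ denotes the quaternions, $\mathbb S=\{I\in\mathbb H: I^2=-1\}$, $\mathbb C_I=\{x+yI:x,y\in\mathbb R\}$ for $I\in\mathbb S$, $m_{2,I}$ is Lebesgue measure on $\mathbb C_I$, and $d\lambda_{\alpha,I}(z)=\frac{\alpha}{\pi}e^{-\alpha|z|^2}dm_{2,I}(z)$. A (left) slice function is $f:\mathbb H\to\mathbb H$ of the form $f(x+yI)=f_0(x,y)+If_1(x,y)$ for all $x,y\in\mathbb R$, $I\in\mathbb S$, where $f_0,f_1:\mathbb R^2\to\mathbb H$ satisfy $f_0(x,-y)=f_0(x,y)$ and $f_1(x,-y)=-f_1(x,y)$. It is slice intrinsic if $f_0,f_1$ are real-valued (equivalently $f(\mathbb C_I)\subseteq\mathbb C_I$ for every $I\in\mathbb S$). $K_\alpha(z,w)=\sum_{n\ge0}\frac{\alpha^n}{n!}z^n\overline w^{\,n}$ and $k_z(w)=K_\alpha(w,z)e^{-\alpha|z|^2/2}$. For $J\perp I$ one has $\mathbb H=\mathbb C_I\oplus\mathbb C_IJ$. $B_{\alpha,I}$ is the classical Berezin transform on $\mathbb C_I$: $B_{\alpha,I}F(z)=\frac{\alpha}{\pi}\int_{\mathbb C_I}e^{-\alpha|w-z|^2}F(w)\,dm_{2,I}(w)$. *)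

(* Defs.v *)
From HB Require Import structures.
From mathcomp Require Import all_boot all_order all_algebra.
From mathcomp Require Import ring.
From mathcomp Require Import all_classical all_reals all_analysis.

Set Implicit Arguments.
Unset Strict Implicit.
Unset Printing Implicit Defensive.

Import Order.TTheory GRing.Theory Num.Theory.
Import numFieldNormedType.Exports.

Local Open Scope classical_set_scope.
Local Open Scope ring_scope.

(* Quat a b c d stands for a + b i + c j + d k. *)
Record quat (R : Type) : Type := Quat { q0 : R; q1 : R; q2 : R; q3 : R }.

Section QuaternionAlgebra.
Context {R : realType}.
Implicit Types p q : quat R.

Definition tuple_of_quat q := (q0 q, q1 q, q2 q, q3 q).
Definition quat_of_tuple (t : R * R * R * R) : quat R :=
  let: (a, b, c, d) := t in Quat a b c d.

Lemma tuple_of_quatK : cancel tuple_of_quat quat_of_tuple.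
Proof. by case. Qed.

HB.instance Definition _ := Choice.copy (quat R) (can_type tuple_of_quatK).

Definition qzero : quat R := Quat 0 0 0 0.
Definition qone : quat R := Quat 1 0 0 0.
Definition qopp q : quat R := Quat (- q0 q) (- q1 q) (- q2 q) (- q3 q).
Definition qadd p q : quat R :=
  Quat (q0 p + q0 q) (q1 p + q1 q) (q2 p + q2 q) (q3 p + q3 q).
Definition qmul p q : quat R :=
  Quat (q0 p * q0 q - q1 p * q1 q - q2 p * q2 q - q3 p * q3 q)
       (q0 p * q1 q + q1 p * q0 q + q2 p * q3 q - q3 p * q2 q)
       (q0 p * q2 q - q1 p * q3 q + q2 p * q0 q + q3 p * q1 q)
       (q0 p * q3 q + q1 p * q2 q - q2 p * q1 q + q3 p * q0 q).
Definition qscale (a : R) q : quat R :=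
  Quat (a * q0 q) (a * q1 q) (a * q2 q) (a * q3 q).

Lemma qaddA : associative qadd.
Proof. by move=> [????] [????] [????]; rewrite /qadd /= !addrA. Qed.
Lemma qaddC : commutative qadd.
Proof. by move=> [????] [????]; rewrite /qadd /=; congr Quat; rewrite addrC. Qed.
Lemma qadd0 : left_id qzero qadd.
Proof. by move=> [????]; rewrite /qadd /= !add0r. Qed.
Lemma qaddN : left_inverse qzero qopp qadd.
Proof. by move=> [????]; rewrite /qadd /= !addNr. Qed.

HB.instance Definition _ :=
  GRing.isZmodule.Build (quat R) qaddA qaddC qadd0 qaddN.

Lemma qmulA : associative qmul.
Proof. by move=> [????] [????] [????]; rewrite /qmul /=; congr Quat; ring. Qed.
Lemma qmul1q : left_id qone qmul.
Proof. by move=> [????]; rewrite /qmul /=; congr Quat; ring. Qed.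
Lemma qmulq1 : right_id qone qmul.
Proof. by move=> [????]; rewrite /qmul /=; congr Quat; ring. Qed.
Lemma qmulDl : left_distributive qmul qadd.
Proof. by move=> [????] [????] [????]; rewrite /qmul /qadd /=; congr Quat; ring. Qed.
Lemma qmulDr : right_distributive qmul qadd.
Proof. by move=> [????] [????] [????]; rewrite /qmul /qadd /=; congr Quat; ring. Qed.
Lemma qone_neq0 : qone != 0 :> quat R.
Proof. by apply/eqP => -[/eqP]; rewrite oner_eq0. Qed.

HB.instance Definition _ := GRing.Zmodule_isNzRing.Build (quat R)
  qmulA qmul1q qmulq1 qmulDl qmulDr qone_neq0.

Lemma qscaleA a b q : qscale a (qscale b q) = qscale (a * b) q.
Proof. by rewrite /qscale /= !mulrA. Qed.
Lemma qscale1 : left_id 1 qscale.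
Proof. by move=> [????]; rewrite /qscale /= !mul1r. Qed.
Lemma qscaleDr : right_distributive qscale +%R.
Proof. by move=> a [????] [????]; rewrite /qscale /=; congr Quat; exact: mulrDr. Qed.
Lemma qscaleDl q : {morph qscale^~ q : a b / a + b}.
Proof. by move=> a b; case: q => ????; rewrite /qscale /=; congr Quat; exact: mulrDl. Qed.

HB.instance Definition _ := GRing.Zmodule_isLmodule.Build R (quat R)
  qscaleA qscale1 qscaleDr qscaleDl.

Lemma qscaleAl (a : R) p q : a *: (p * q) = a *: p * q.
Proof.
by case: p q => [????] [????]; rewrite /GRing.scale /GRing.mul /= /qscale /qmul /=;
  congr Quat; ring.
Qed.

HB.instance Definition _ := GRing.Lmodule_isLalgebra.Build R (quat R) qscaleAl.

End QuaternionAlgebra.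

Section SliceFunctions.
Context {R : realType}.
Implicit Types (p q z w I J : quat R) (f g : quat R -> quat R).

Definition qconj q : quat R := Quat (q0 q) (- q1 q) (- q2 q) (- q3 q).

Definition qdot p q : R :=
  q0 p * q0 q + q1 p * q1 q + q2 p * q2 q + q3 p * q3 q.

Definition qnorm q : R := Num.sqrt (qdot q q).

Definition qorth p q : Prop := qdot p q = 0.

(* The real quaternions. *)
Definition qreal : set (quat R) := [set q | exists a : R, q = a%:A].

(* The sphere S of imaginary units. *)
Definition imag_unit : set (quat R) := [set I | I * I = -1].

Definition slice_pt I (xy : R * R) : quat R := xy.1%:A + xy.2 *: I.

(* The complex plane C_I. *)
Definition slice_plane I : set (quat R) := range (slice_pt I).

Definition slice_components f (f0 f1 : R -> R -> quat R) : Prop :=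
  [/\ forall x y, f0 x (- y) = f0 x y,
      forall x y, f1 x (- y) = - f1 x y
    & forall x y I, imag_unit I -> f (slice_pt I (x, y)) = f0 x y + I * f1 x y].

Definition slice_function f : Prop :=
  exists f0 f1 : R -> R -> quat R, slice_components f f0 f1.

Definition slice_intrinsic f : Prop :=
  exists f0 f1 : R -> R -> quat R, slice_components f f0 f1 /\
    forall x y, qreal (f0 x y) /\ qreal (f1 x y).

End SliceFunctions.

(* Lebesgue measure on R * R: the completion of the product Borel measure, so
   that its measurable sets are the Lebesgue measurable ones. *)
Definition lebesgue2 {R : realType} :=
  @completed_measure_extension _ _ R
    (@lebesgue_measure R \x @lebesgue_measure R)%E.

HB.instance Definition _ {R : realType} := Measure.on (@lebesgue2 R).

(* Integration over C_I: for an imaginary unit I, slice_pt I is an isometry of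
   R * R onto C_I, which transports lebesgue2 to m_{2,I}. Quaternion-valued
   functions are measured and integrated coordinatewise. *)
Section SliceIntegral.
Context {R : realType}.
Implicit Types (I : quat R) (g : quat R -> quat R).

Local Notation T := (caratheodory_type
  ((@lebesgue_measure R \x @lebesgue_measure R)%E^*)%mu).

Definition slice_coord (c : quat R -> R) I g : T -> R :=
  fun xy => c (g (slice_pt I xy)).

Definition slice_measurable I g : Prop :=
  [/\ measurable_fun setT (slice_coord (@q0 R) I g),
      measurable_fun setT (slice_coord (@q1 R) I g),
      measurable_fun setT (slice_coord (@q2 R) I g)
    & measurable_fun setT (slice_coord (@q3 R) I g)].

Definition slice_integrable I g : Prop :=
  [/\ lebesgue2.-integrable setT (EFin \o slice_coord (@q0 R) I g),
      lebesgue2.-integrable setT (EFin \o slice_coord (@q1 R) I g),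
      lebesgue2.-integrable setT (EFin \o slice_coord (@q2 R) I g)
    & lebesgue2.-integrable setT (EFin \o slice_coord (@q3 R) I g)].

Definition slice_integral I g : quat R :=
  Quat (\int[lebesgue2]_xy slice_coord (@q0 R) I g xy)
       (\int[lebesgue2]_xy slice_coord (@q1 R) I g xy)
       (\int[lebesgue2]_xy slice_coord (@q2 R) I g xy)
       (\int[lebesgue2]_xy slice_coord (@q3 R) I g xy).

Definition slice_eintegral I (h : quat R -> \bar R) : \bar R :=
  \int[lebesgue2]_(xy in setT) h (slice_pt I (xy : T)).

End SliceIntegral.

Section Berezin.
Context {R : realType}.
Implicit Types (alpha : R) (z w I : quat R) (f Bf : quat R -> quat R).

(* The density of lambda_{alpha,I} with respect to m_{2,I}. *)
Definition fock_weight alpha z : R :=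
  alpha / pi * expR (- (alpha * qnorm z ^+ 2)).

Definition qseries (u : nat -> quat R) : quat R :=
  Quat (limn (series (fun n => q0 (u n)))) (limn (series (fun n => q1 (u n))))
       (limn (series (fun n => q2 (u n)))) (limn (series (fun n => q3 (u n)))).

Definition fock_kernel alpha z w : quat R :=
  qseries (fun n => (alpha ^+ n / n`!%:R) *: (z ^+ n * qconj w ^+ n)).

(* k_z(w) *)
Definition normalized_kernel alpha z w : quat R :=
  expR (- (alpha * qnorm z ^+ 2 / 2)) *: fock_kernel alpha w z.

(* The integrand of \int |k_z(w)|^2 f(w) dlambda_{alpha,I}(w), as a density
   with respect to m_{2,I}. *)
Definition berezin_integrand alpha f z w : quat R :=
  fock_weight alpha w *: (qnorm (normalized_kernel alpha z w) ^+ 2 *: f w).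

Definition gauss_integrand alpha f z w : quat R :=
  expR (- (alpha * qnorm (w - z) ^+ 2)) *: f w.

(* The classical Berezin transform on C_I; f may take values in all of H. *)
Definition classical_berezin alpha I f z : quat R :=
  (alpha / pi) *: slice_integral I (gauss_integrand alpha f z).

(* Bf is given at every point by the convergent slice-wise integral. This
   determines Bf, the planes C_I covering H, and asks in particular that the
   integrals over different planes through one point agree. *)
Definition is_berezin_transform alpha f Bf : Prop :=
  forall I z, imag_unit I -> slice_plane I z ->
    slice_integrable I (berezin_integrand alpha f z) /\
    Bf z = slice_integral I (berezin_integrand alpha f z).

End Berezin.

(* Main.v *)
Require Import Defs.
From HB Require Import structures.
From mathcomp Require Import all_boot all_order all_algebra.
From mathcomp Require Import ring lra.
From mathcomp Require Import all_classical all_reals all_analysis measurable_realfun.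
Set Implicit Arguments.
Unset Strict Implicit.
Unset Printing Implicit Defensive.
Import Order.TTheory GRing.Theory Num.Theory.
Import numFieldNormedType.Exports.
Local Open Scope classical_set_scope.
Local Open Scope ring_scope.

(** With [z = x + y I] and [w = u + v I] in [C_I], the kernel is the planar
    exponential [exp (alpha w z^bar)], so [|k_z(w)|^2] against the Fock weight
    is the Gaussian [alpha / pi * exp (- alpha |w - z|^2)], which depends on
    [(x, y)] and [(u, v)] but not on [I].  Since [- I] is an imaginary unit
    too, the slice components [f0], [f1] of [f] are combinations of
    [f (u + v I)] and [f (u - v I)], hence integrable against the Gaussian,
    and the transform of [f] at [x + y I] is [B f0 (x, y) + I * B f1 (x, y)].
    The parities of [B f0] and [B f1] in [y] come from the invariance of
    planar Lebesgue measure under [(u, v) |-> (u, - v)], and the splitting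
    [f = F + G J] is recovered from conjugation by [I]. *)

(** * The planar exponential *)

Section PlanarExponential.
Context {R : realType}.
Implicit Types s t a b x : R.

(* Real and imaginary parts of [(s + t i) ^ n]. *)
Definition cpow s t (n : nat) : R * R :=
  iter n (fun p => (s * p.1 - t * p.2, t * p.1 + s * p.2)) (1, 0).

(* Real linear combinations of the coefficients of [Re e^((s + t i) x)] and
   [Im e^((s + t i) x)]: a family stable under differentiation in [x]. *)
Definition cexp_coeff s t a b (n : nat) : R :=
  (a * (cpow s t n).1 + b * (cpow s t n).2) / n`!%:R.

Definition cexp_sum s t a b x : R := limn (pseries (cexp_coeff s t a b) x).

(** The norm [|u| + |v|] of [u + v i] is submultiplicative: one multiplication by [s + t i] enlarges
    it at most by the factor [|s| + |t|]. *)
Lemma cpow_bound s t n :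
  `|(cpow s t n).1| + `|(cpow s t n).2| <= (`|s| + `|t|) ^+ n.
Proof.
elim: n => [|n IHn]; first by rewrite normr0 normr1 addr0 expr0.
rewrite exprS (le_trans _ (ler_wpM2l _ IHn)) ?addr_ge0//=.
set u := (cpow s t n).1; set v := (cpow s t n).2.
have h1 := ler_normB (s * u) (t * v); have h2 := ler_normD (t * u) (s * v).
move: h1 h2; rewrite !normrM => h1 h2; lra.
Qed.

(** Domination by [|a| + |b|] times the exponential series at [(|s| + |t|) |x|]. *)
Lemma is_cvg_cexp s t a b x : cvgn (pseries (cexp_coeff s t a b) x).
Proof.
apply: normed_cvg.
pose y : R := (`|s| + `|t|) * `|x|; pose c : R := `|a| + `|b|.
apply: (@series_le_cvg _ _ (c *: exp_coeff y)) => [n|n|n|].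
- exact: normr_ge0.
- by rewrite /exp_coeff /= mulr_ge0 ?addr_ge0// divr_ge0 ?exprn_ge0 ?mulr_ge0 ?addr_ge0.
- have -> : (c *: exp_coeff y) n = c * (`|s| + `|t|) ^+ n / n`!%:R * `|x| ^+ n.
    by rewrite /GRing.scale /= /exp_coeff /= /GRing.scale /= /y exprMn; ring.
  rewrite /= normrM normrX ler_wpM2r ?exprn_ge0//.
  rewrite /cexp_coeff normrM (@ger0_norm _ (_^-1)) ?invr_ge0//.
  rewrite ler_wpM2r ?invr_ge0//.
  have := cpow_bound s t n; set u := (cpow s t n).1; set v := (cpow s t n).2.
  move=> h; apply: (le_trans (ler_normD _ _)); rewrite !normrM.
  apply: (le_trans _ (ler_wpM2l _ h)); last by rewrite addr_ge0.
  have a0 := normr_ge0 a; have b0 := normr_ge0 b.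
  have u0 := normr_ge0 u; have v0 := normr_ge0 v.
  by rewrite mulrDl !mulrDr; nra.
- exact/is_cvg_seriesZ/is_cvg_series_exp_coeff.
Qed.

(** Differentiation shifts [cpow] by one step, that is, multiplies by [s + t i]; the new pair of
    coefficients is the transpose of this multiplication applied to [(a, b)]. *)
Lemma pseries_diffs_cexp s t a b :
  pseries_diffs (cexp_coeff s t a b) = cexp_coeff s t (a * s + b * t) (b * s - a * t).
Proof.
apply/funext => n; rewrite /pseries_diffs /cexp_coeff factS natrM invfM /=.
have n0 : n.+1%:R != 0 :> R by rewrite pnatr_eq0.
have f0 : n`!%:R != 0 :> R by rewrite pnatr_eq0 -lt0n fact_gt0.
by field; rewrite f0 nat1r n0.
Qed.

Lemma cexp_sumE s t a b x :
  cexp_sum s t a b x = a * cexp_sum s t 1 0 x + b * cexp_sum s t 0 1 x.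
Proof.
rewrite -[a * _]/(a *: _) -[b * _]/(b *: _) /cexp_sum /pseries -!lim_seriesZ;
  try exact: is_cvg_cexp.
rewrite -lim_seriesD; try exact/is_cvg_seriesZ/is_cvg_cexp.
congr (limn (series _)); apply/funext => n.
by rewrite !fctE /cexp_coeff /GRing.scale /=; ring.
Qed.

Lemma cexp_sum0 s t a b : cexp_sum s t a b 0 = a.
Proof.
apply: lim_near_cst => //; near=> m; rewrite -[m]prednK; last by near: m.
rewrite /pseries /series /= big_nat_recl//= big1 => [|i _].
  by rewrite /cexp_coeff /= expr0 fact0; field.
by rewrite expr0n mulr0.
Unshelve. all: by end_near. Qed.

Lemma is_derive_cexp s t a b x :
  is_derive x (1 : R) (cexp_sum s t a b)
    (cexp_sum s t (a * s + b * t) (b * s - a * t) x).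
Proof.
rewrite /cexp_sum -pseries_diffs_cexp.
apply: (@pseries_snd_diffs _ _ (`|x| + 1)); rewrite ?pseries_diffs_cexp;
  try exact: is_cvg_cexp.
by rewrite [ltRHS]ger0_norm ?ltrDl// addr_ge0.
Qed.

(* The left-hand side, times [expR (- 2 s x)], has derivative 0. *)
Lemma sqr_cexp_sum s t x :
  cexp_sum s t 1 0 x ^+ 2 + cexp_sum s t 0 1 x ^+ 2 = expR (2 * s * x).
Proof.
pose c := cexp_sum s t 1 0; pose d := cexp_sum s t 0 1.
pose h y := (c y * c y + d y * d y) * expR (- (2 * s) * y).
have dc y : is_derive y (1 : R) c (s * c y - t * d y).
  by have := is_derive_cexp s t 1 0 y; rewrite cexp_sumE => H;
    apply: trigger_derive H _; rewrite -/c -/d; ring.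
have dd y : is_derive y (1 : R) d (t * c y + s * d y).
  by have := is_derive_cexp s t 0 1 y; rewrite cexp_sumE => H;
    apply: trigger_derive H _; rewrite -/c -/d; ring.
have hE : h x = h 0.
  apply: is_derive_0_is_cst => y; rewrite /h; apply: trigger_derive.
  by rewrite /GRing.scale /=; ring.
have : h x = 1 by rewrite hE /h /c /d !cexp_sum0 !mulr0 expR0; ring.
rewrite /h mulNr expRN -!expr2 => /(congr1 ( *%R^~ (expR (2 * s * x)))).
by rewrite mul1r mulfVK ?expR_eq0.
Qed.

End PlanarExponential.

(** * Slice planes and the Fock kernel *)

Section SlicePlanes.
Context {R : realType}.
Implicit Types (I J p q z w : quat R) (s t a b x y : R).

Lemma quatP p q : q0 p = q0 q -> q1 p = q1 q -> q2 p = q2 q -> q3 p = q3 q -> p = q.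
Proof. by case: p q => [????] [????] /= -> -> -> ->. Qed.

Lemma q0D p q : q0 (p + q) = q0 p + q0 q. Proof. by []. Qed.
Lemma q1D p q : q1 (p + q) = q1 p + q1 q. Proof. by []. Qed.
Lemma q2D p q : q2 (p + q) = q2 p + q2 q. Proof. by []. Qed.
Lemma q3D p q : q3 (p + q) = q3 p + q3 q. Proof. by []. Qed.
Lemma q0N p : q0 (- p) = - q0 p. Proof. by []. Qed.
Lemma q1N p : q1 (- p) = - q1 p. Proof. by []. Qed.
Lemma q2N p : q2 (- p) = - q2 p. Proof. by []. Qed.
Lemma q3N p : q3 (- p) = - q3 p. Proof. by []. Qed.
Lemma q0Z a p : q0 (a *: p) = a * q0 p. Proof. by []. Qed.
Lemma q1Z a p : q1 (a *: p) = a * q1 p. Proof. by []. Qed.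
Lemma q2Z a p : q2 (a *: p) = a * q2 p. Proof. by []. Qed.
Lemma q3Z a p : q3 (a *: p) = a * q3 p. Proof. by []. Qed.
Lemma q0M p q : q0 (p * q) = q0 p * q0 q - q1 p * q1 q - q2 p * q2 q - q3 p * q3 q.
Proof. by []. Qed.
Lemma q1M p q : q1 (p * q) = q0 p * q1 q + q1 p * q0 q + q2 p * q3 q - q3 p * q2 q.
Proof. by []. Qed.
Lemma q2M p q : q2 (p * q) = q0 p * q2 q - q1 p * q3 q + q2 p * q0 q + q3 p * q1 q.
Proof. by []. Qed.
Lemma q3M p q : q3 (p * q) = q0 p * q3 q + q1 p * q2 q - q2 p * q1 q + q3 p * q0 q.
Proof. by []. Qed.

Definition quatE := ((q0D, q1D, q2D, q3D), (q0N, q1N, q2N, q3N),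
  (q0Z, q1Z, q2Z, q3Z), (q0M, q1M, q2M, q3M)).

Lemma qscaleAr a p q : a *: (p * q) = p * (a *: q).
Proof. by apply: quatP; rewrite !quatE; ring. Qed.

Lemma imag_unitP I : imag_unit I <->
  q0 I = 0 /\ q1 I ^+ 2 + q2 I ^+ 2 + q3 I ^+ 2 = 1.
Proof.
split=> [II|[I0 I1]]; last first.
  by apply: quatP; rewrite !quatE I0 /=; lra.
have e0 := congr1 (@q0 R) II; have e1 := congr1 (@q1 R) II.
have e2 := congr1 (@q2 R) II; have e3 := congr1 (@q3 R) II.
rewrite !quatE /= in e0 e1 e2 e3.
(* The imaginary coordinates of [I * I = -1] read [2 (q0 I) u = 0]. Were [q0 I] nonzero, the vector
   part would vanish and the real coordinate would say [(q0 I) ^ 2 = -1]. *)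
have I0 : q0 I = 0.
  case: (eqVneq (q0 I) 0) => // n0.
  have z u : q0 I * u + q0 I * u = 0 -> u = 0.
    move=> h; apply: (mulfI n0); rewrite mulr0; lra.
  have I1 : q1 I = 0 by apply: z; lra.
  have I2 : q2 I = 0 by apply: z; lra.
  have I3 : q3 I = 0 by apply: z; lra.
  move: e0; rewrite I1 I2 I3 => e0.
  by have := sqr_ge0 (q0 I); rewrite expr2 => ?; lra.
split=> //; move: e0; rewrite I0; lra.
Qed.

Lemma imag_unitN I : imag_unit I -> imag_unit (- I).
Proof. by rewrite /imag_unit /= mulrNN. Qed.

Lemma q0_slice_pt I a b : imag_unit I -> q0 (slice_pt I (a, b)) = a.
Proof. by move=> /imag_unitP[I0 _]; rewrite !quatE I0 /=; ring. Qed.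

Lemma slice_ptM I a b x y : imag_unit I ->
  slice_pt I (a, b) * slice_pt I (x, y) = slice_pt I (a * x - b * y, a * y + b * x).
Proof.
move=> II; rewrite /slice_pt /= mulrDl !mulrDr -!scalerAl -!qscaleAr II !mul1r mulr1.
by apply: quatP; rewrite !quatE /=; ring.
Qed.

Lemma slice_ptX I a b n : imag_unit I ->
  slice_pt I (a, b) ^+ n = slice_pt I (cpow a b n).
Proof.
move=> II; elim: n => [|n IHn]; first by rewrite /slice_pt /= scale0r addr0 scale1r.
rewrite exprS IHn [cpow _ _ n]surjective_pairing slice_ptM//.
by congr slice_pt; congr pair; rewrite addrC.
Qed.

Lemma qconj_slice_pt I a b : imag_unit I ->
  qconj (slice_pt I (a, b)) = slice_pt I (a, - b).
Proof.
by move=> /imag_unitP[I0 _]; apply: quatP; rewrite /qconj /slice_pt !quatE /= ?I0; ring.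
Qed.

Lemma qdot_ge0 p : 0 <= qdot p p.
Proof. by rewrite /qdot !addr_ge0// -expr2 sqr_ge0. Qed.

Lemma sqr_qnorm p : qnorm p ^+ 2 = qdot p p.
Proof. by rewrite sqr_sqrtr ?qdot_ge0. Qed.

Lemma sqr_qnorm_slice_pt I a b : imag_unit I ->
  qnorm (slice_pt I (a, b)) ^+ 2 = a ^+ 2 + b ^+ 2.
Proof.
move=> /imag_unitP[I0 I1]; rewrite sqr_qnorm -[in RHS](mulr1 (b ^+ 2)) -I1 /qdot.
by rewrite /slice_pt !quatE /= I0; ring.
Qed.

Lemma sqr_qnormZ a p : qnorm (a *: p) ^+ 2 = a ^+ 2 * qnorm p ^+ 2.
Proof. by rewrite !sqr_qnorm /qdot !quatE; ring. Qed.

(** The product of [a + b I] and the conjugate of [x + y I] is [s + t I]. Both factors lie in the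
    commutative plane [C_I], so the kernel is the exponential series of [alpha (s + t I)]. *)
Lemma fock_kernel_slice_pt alpha I a b x y : imag_unit I ->
  let s := a * x + b * y in let t := b * x - a * y in
  fock_kernel alpha (slice_pt I (a, b)) (slice_pt I (x, y)) =
  slice_pt I (cexp_sum s t 1 0 alpha, cexp_sum s t 0 1 alpha).
Proof.
move=> II s t; have [I0 _] := (imag_unitP I).1 II.
have termE n : (alpha ^+ n / n`!%:R) *: (slice_pt I (a, b) ^+ n *
    qconj (slice_pt I (x, y)) ^+ n) =
    slice_pt I (cexp_coeff s t 1 0 n * alpha ^+ n, cexp_coeff s t 0 1 n * alpha ^+ n).
  have comm : GRing.comm (slice_pt I (a, b)) (slice_pt I (x, - y)).
    by rewrite /GRing.comm !slice_ptM//; congr slice_pt; congr pair; ring.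
  rewrite qconj_slice_pt// -exprMn_comm// slice_ptM//.
  rewrite (_ : (_, _) = (s, t)); last by rewrite /s /t; congr pair; ring.
  rewrite slice_ptX// /cexp_coeff [cpow s t n]surjective_pairing /slice_pt /=.
  by apply: quatP; rewrite !quatE /=; ring.
(* [qseries] sums coordinate by coordinate; each coordinate is a real-linear form, hence passes
   through the limit. *)
have coordE (c : quat R -> R) : (forall r p, c (r *: p) = r * c p) ->
    (forall p q, c (p + q) = c p + c q) ->
    limn (series (fun n => c ((alpha ^+ n / n`!%:R) *: (slice_pt I (a, b) ^+ n *
      qconj (slice_pt I (x, y)) ^+ n)))) =
    c (slice_pt I (cexp_sum s t 1 0 alpha, cexp_sum s t 0 1 alpha)).
  move=> cZ cD; rewrite /slice_pt /= cD !cZ.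
  rewrite mulrC [cexp_sum s t 0 1 _ * _]mulrC.
  rewrite -[c 1 * _]/(c 1 *: _) -[c I * _]/(c I *: _) /cexp_sum /pseries.
  rewrite -!lim_seriesZ; try exact: is_cvg_cexp.
  rewrite -lim_seriesD; try exact/is_cvg_seriesZ/is_cvg_cexp.
  congr (limn (series _)); apply/funext => n; rewrite !fctE termE /slice_pt /= cD !cZ.
  by rewrite /GRing.scale /=; ring.
by apply: quatP; apply: coordE.
Qed.

Lemma sqr_qnorm_fock_kernel alpha I a b x y : imag_unit I ->
  qnorm (fock_kernel alpha (slice_pt I (a, b)) (slice_pt I (x, y))) ^+ 2 =
  expR (2 * (a * x + b * y) * alpha).
Proof.
by move=> II; rewrite fock_kernel_slice_pt// sqr_qnorm_slice_pt// sqr_cexp_sum.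
Qed.

Lemma slice_ptB I a b x y :
  slice_pt I (a, b) - slice_pt I (x, y) = slice_pt I (a - x, b - y).
Proof. by apply: quatP; rewrite /slice_pt !quatE /=; ring. Qed.

Definition gauss2 alpha (xy uv : R * R) : R :=
  expR (- (alpha * ((uv.1 - xy.1) ^+ 2 + (uv.2 - xy.2) ^+ 2))).

(** Completing the square: [2 Re (w z^bar) - |w|^2 = |z|^2 - |w - z|^2]. The factor in front of the
    Gaussian does not depend on the integration variable [uv]. *)
Lemma fock_weight_kernel alpha I (xy uv : R * R) : imag_unit I ->
  fock_weight alpha (slice_pt I uv) *
    qnorm (fock_kernel alpha (slice_pt I uv) (slice_pt I xy)) ^+ 2 =
  alpha / pi * expR (alpha * (xy.1 ^+ 2 + xy.2 ^+ 2)) * gauss2 alpha xy uv.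
Proof.
case: xy uv => [x y] [a b] II; rewrite /fock_weight sqr_qnorm_fock_kernel//.
rewrite sqr_qnorm_slice_pt// /gauss2 /= -!mulrA -!expRD.
by congr (_ * (_ * expR _)); ring.
Qed.

Lemma gauss_integrand_slice_pt alpha f I (xy uv : R * R) : imag_unit I ->
  gauss_integrand alpha f (slice_pt I xy) (slice_pt I uv) =
  gauss2 alpha xy uv *: f (slice_pt I uv).
Proof.
case: xy uv => [x y] [a b] II.
by rewrite /gauss_integrand slice_ptB sqr_qnorm_slice_pt.
Qed.

(** The squared normalization [exp (- alpha |z|^2)] of [k_z] cancels the factor left over by
    completing the square. *)
Lemma berezin_integrand_slice_pt alpha f I (xy uv : R * R) : imag_unit I ->
  berezin_integrand alpha f (slice_pt I xy) (slice_pt I uv) =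
  (alpha / pi) *: (gauss2 alpha xy uv *: f (slice_pt I uv)).
Proof.
case: xy uv => [x y] [a b] II; rewrite /berezin_integrand /normalized_kernel.
rewrite sqr_qnormZ sqr_qnorm_fock_kernel// /fock_weight !sqr_qnorm_slice_pt//.
rewrite !scalerA /gauss2 /= [expR _ ^+ 2]expr2 -expRD -!mulrA -!expRD.
by congr ((_ * (_ * expR _)) *: _); field.
Qed.

End SlicePlanes.

(** * Planar Lebesgue measure under reflection *)

Section PlanarLebesgue.
Context {R : realType}.

Local Notation mu := (@lebesgue_measure R).
Local Notation mu2 := (mu \x mu)%E.
Local Notation T := (caratheodory_type ((mu \x mu)%E^*)%mu).

Definition reflect2 (xy : R * R) : R * R := (xy.1, - xy.2).

Lemma reflect2K : involutive reflect2.
Proof. by case=> x y; rewrite /reflect2 /= opprK. Qed.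

Lemma preimage_reflect2K : involutive (preimage reflect2).
Proof. by move=> A; rewrite -comp_preimage (_ : _ \o _ = id)//; apply/funext/reflect2K. Qed.

(** Borel sets of the plane are Caratheodory measurable, so Borel functions stay measurable for the
    completed measure. *)
Lemma measurable_lebesgue2 (h : measurableTypeR R * measurableTypeR R -> R) :
  measurable_fun setT h -> measurable_fun (setT : set T) (h : T -> R).
Proof.
move=> mh _ Y mY; apply: caratheodory_measurable_mu_ext.
exact: mh.
Qed.

Lemma measurable_reflect2 :
  measurable_fun setT (reflect2 : measurableTypeR R * measurableTypeR R ->
    measurableTypeR R * measurableTypeR R).
Proof.
apply/measurable_fun_pairP; split; first exact: measurable_fst.
by have := measurable_funN (@measurable_snd _ _ (measurableTypeR R) (measurableTypeR R)).
Qed.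

(** The image of the product measure under the reflection agrees with it on rectangles, because
    Lebesgue measure on the line is invariant under negation; rectangles determine the product
    measure. *)
Lemma product_lebesgue_reflect2 (A : set (measurableTypeR R * measurableTypeR R)) :
  measurable A -> mu2 (reflect2 @^-1` A) = mu2 A.
Proof.
move=> mA.
pose rf : {mfun (measurableTypeR R * measurableTypeR R)%type >->
    (measurableTypeR R * measurableTypeR R)%type} :=
  HB.pack_for {mfun (measurableTypeR R * measurableTypeR R)%type >->
    (measurableTypeR R * measurableTypeR R)%type} reflect2
    (isMeasurableFun.Build _ _ _ _ _ measurable_reflect2).
apply/esym.
apply: (@product_measure_unique _ _ _ _ _ mu mu (pushforward mu2 rf)) => // B C mB mC.
transitivity (mu2 (B `*` (-%R @^-1` C))); first by [].
rewrite product_measure1E//; first by congr (_ * _)%E; exact: lebesgue_measureN.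
by rewrite -[X in measurable X]setTI; exact: oppr_measurable.
Qed.

(** The value on [A] is an infimum over countable Borel covers, and reflecting a cover of [A] gives
    a cover of the reflected set with the same total measure. This works for arbitrary [A], and the
    involution then turns the inequality into an equality. *)
Lemma lebesgue2_reflect2_le (A : set T) :
  (lebesgue2 (reflect2 @^-1` A) <= lebesgue2 A)%E.
Proof.
apply: le_ereal_inf_tmp => _ [B [mB AB] <-].
apply: ereal_inf_lbound.
have mreflect n : measurable (reflect2 @^-1` B n).
  by rewrite -[X in measurable X]setTI; apply: measurable_reflect2;
    [exact: measurableT | exact: mB].
exists (fun n => reflect2 @^-1` B n); first split.
- exact: mreflect.
- by rewrite -preimage_bigcup; exact: preimage_subset.
- by apply: eq_eseriesr => n _; apply: product_lebesgue_reflect2; exact: mB.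
Qed.

Lemma lebesgue2_reflect2 (A : set T) : lebesgue2 (reflect2 @^-1` A) = lebesgue2 A.
Proof.
apply/eqP; rewrite eq_le lebesgue2_reflect2_le /=.
by rewrite -[leLHS](congr1 _ (preimage_reflect2K A)); exact: lebesgue2_reflect2_le.
Qed.

Lemma measurable_lebesgue2_reflect2 : measurable_fun (setT : set T) (reflect2 : T -> T).
Proof.
have E (B : set (R * R)) : (mu2^*)%mu (reflect2 @^-1` B) = (mu2^*)%mu B.
  exact: lebesgue2_reflect2.
move=> _ A mA; rewrite setTI.
have cA : caratheodory_measurable (mu2^*)%mu A := mA.
suff : caratheodory_measurable (mu2^*)%mu (reflect2 @^-1` A) by [].
(* Testing the Caratheodory condition for the reflected set on [X] amounts to testing it for [A] on
   the reflection of [X]. *)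
move=> X; rewrite -E (cA (reflect2 @^-1` X)) -E preimage_setI.
by rewrite -(E (_ `&` ~` A)) preimage_setI preimage_setC !preimage_reflect2K.
Qed.

Lemma pushforward_lebesgue2_reflect2 :
  pushforward (lebesgue2 : set T -> \bar R) (reflect2 : T -> T) = lebesgue2.
Proof. by apply/funext => A; exact: lebesgue2_reflect2. Qed.

Lemma integrable_lebesgue2_reflect2 (h : T -> \bar R) :
  lebesgue2.-integrable setT h ->
  lebesgue2.-integrable setT (h \o reflect2).
Proof.
move=> /integrableP[mh hoo]; apply/integrableP; split.
  exact: (measurableT_comp mh measurable_lebesgue2_reflect2).
have mabs : measurable_fun setT (fun x => `|h x|)%E by exact: measurableT_comp.
have := ge0_integral_pushforward measurable_lebesgue2_reflect2 lebesgue2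
  measurableT mabs (fun x _ => abse_ge0 (h x)).
by rewrite pushforward_lebesgue2_reflect2 => <-.
Qed.

Lemma Rintegral_lebesgue2_reflect2 (h : T -> R) :
  lebesgue2.-integrable setT (EFin \o h) ->
  \int[lebesgue2]_xy h (reflect2 xy) = \int[lebesgue2]_xy h xy.
Proof.
move=> ih; have /integrableP[mh _] := ih.
have := integral_pushforward measurable_lebesgue2_reflect2 mh
  (integrable_lebesgue2_reflect2 ih) measurableT.
by rewrite pushforward_lebesgue2_reflect2 => /(congr1 fine).
Qed.

End PlanarLebesgue.

(** * Quaternion-valued integrals *)

Section QuaternionIntegral.
Context d (X : measurableType d) (R : realType) (mu : {measure set X -> \bar R}).
Implicit Types (g h : X -> quat R) (p : quat R).

(** Together with [qintegral], the form of [slice_integrable] and [slice_integral] for integrands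
    given on the parameter space; at [h = g \o slice_pt I] they unfold to the same statements. Slice
    components, which are functions of [(u, v)], can be integrated this way. *)
Definition qintegrable h : Prop :=
  [/\ mu.-integrable setT (EFin \o (fun x => q0 (h x))),
      mu.-integrable setT (EFin \o (fun x => q1 (h x))),
      mu.-integrable setT (EFin \o (fun x => q2 (h x)))
    & mu.-integrable setT (EFin \o (fun x => q3 (h x)))].

Definition qintegral h : quat R :=
  Quat (\int[mu]_x q0 (h x)) (\int[mu]_x q1 (h x))
       (\int[mu]_x q2 (h x)) (\int[mu]_x q3 (h x)).

(** Meant for [k] a coordinate of [p * h] or [h * p]; the coefficients [a], [b], [c], [e] are a row
    of the matrix of that multiplication. *)
Lemma integrable_qlinear h (k : R -> R -> R -> R -> R) (a b c e : R) :
  (forall x y z t, k x y z t = a * x + b * y + c * z + e * t) -> qintegrable h ->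
  mu.-integrable setT (EFin \o (fun x => k (q0 (h x)) (q1 (h x)) (q2 (h x)) (q3 (h x)))) /\
  \int[mu]_x k (q0 (h x)) (q1 (h x)) (q2 (h x)) (q3 (h x)) =
  k (\int[mu]_x q0 (h x)) (\int[mu]_x q1 (h x))
    (\int[mu]_x q2 (h x)) (\int[mu]_x q3 (h x)).
Proof.
move=> kE [i0 i1 i2 i3].
have iZ r (u : X -> R) : mu.-integrable setT (EFin \o u) ->
    mu.-integrable setT (EFin \o (fun x => r * u x)) by exact: integrableZl.
have iD (u v : X -> R) : mu.-integrable setT (EFin \o u) ->
    mu.-integrable setT (EFin \o v) ->
    mu.-integrable setT (EFin \o (fun x => u x + v x)) by exact: integrableD.
have j0 := iZ a _ i0; have j1 := iZ b _ i1; have j2 := iZ c _ i2; have j3 := iZ e _ i3.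
have j01 := iD _ _ j0 j1; have j012 := iD _ _ j01 j2.
rewrite (_ : (fun x => k _ _ _ _) = (fun x => a * q0 (h x) + b * q1 (h x) +
  c * q2 (h x) + e * q3 (h x))); last by apply/funext => x; rewrite kE.
split; first exact: (iD _ _ j012 j3).
by rewrite kE (RintegralD _ j012)// (RintegralD _ j01)// (RintegralD _ j0)// !RintegralZl.
Qed.

Lemma qintegrableD g h : qintegrable g -> qintegrable h ->
  qintegrable (fun x => g x + h x).
Proof.
have iD (u v : X -> R) : mu.-integrable setT (EFin \o u) ->
    mu.-integrable setT (EFin \o v) ->
    mu.-integrable setT (EFin \o (fun x => u x + v x)) by exact: integrableD.
by move=> [????] [????]; split; exact: iD.
Qed.

Lemma qintegralD g h : qintegrable g -> qintegrable h ->
  qintegral (fun x => g x + h x) = qintegral g + qintegral h.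
Proof. by move=> [????] [????]; apply: quatP; exact: RintegralD. Qed.

Lemma qintegralMl p h : qintegrable h ->
  qintegrable (fun x => p * h x) /\ qintegral (fun x => p * h x) = p * qintegral h.
Proof.
move=> ih.
have [i0 e0] := @integrable_qlinear h (fun x y z t => q0 (p * Quat x y z t))
  (q0 p) (- q1 p) (- q2 p) (- q3 p) ltac:(by move=> * /=; ring) ih.
have [i1 e1] := @integrable_qlinear h (fun x y z t => q1 (p * Quat x y z t))
  (q1 p) (q0 p) (- q3 p) (q2 p) ltac:(by move=> * /=; ring) ih.
have [i2 e2] := @integrable_qlinear h (fun x y z t => q2 (p * Quat x y z t))
  (q2 p) (q3 p) (q0 p) (- q1 p) ltac:(by move=> * /=; ring) ih.
have [i3 e3] := @integrable_qlinear h (fun x y z t => q3 (p * Quat x y z t))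
  (q3 p) (- q2 p) (q1 p) (q0 p) ltac:(by move=> * /=; ring) ih.
by split; [split | apply: quatP].
Qed.

Lemma qintegralMr p h : qintegrable h ->
  qintegrable (fun x => h x * p) /\ qintegral (fun x => h x * p) = qintegral h * p.
Proof.
move=> ih.
have [i0 e0] := @integrable_qlinear h (fun x y z t => q0 (Quat x y z t * p))
  (q0 p) (- q1 p) (- q2 p) (- q3 p) ltac:(by move=> * /=; ring) ih.
have [i1 e1] := @integrable_qlinear h (fun x y z t => q1 (Quat x y z t * p))
  (q1 p) (q0 p) (q3 p) (- q2 p) ltac:(by move=> * /=; ring) ih.
have [i2 e2] := @integrable_qlinear h (fun x y z t => q2 (Quat x y z t * p))
  (q2 p) (- q3 p) (q0 p) (q1 p) ltac:(by move=> * /=; ring) ih.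
have [i3 e3] := @integrable_qlinear h (fun x y z t => q3 (Quat x y z t * p))
  (q3 p) (q2 p) (- q1 p) (q0 p) ltac:(by move=> * /=; ring) ih.
by split; [split | apply: quatP].
Qed.

Lemma qintegralZ (a : R) h : qintegrable h ->
  qintegrable (fun x => a *: h x) /\ qintegral (fun x => a *: h x) = a *: qintegral h.
Proof.
by move=> /(@qintegralMl (a *: 1))[]; under eq_fun do rewrite -scalerAl mul1r;
  rewrite -scalerAl mul1r.
Qed.

Lemma eq_qintegrable g h : g =1 h -> qintegrable g -> qintegrable h.
Proof. by move=> /funext ->. Qed.

End QuaternionIntegral.

(** * Gaussian integrals of slice components *)

Section GaussianIntegrals.
Context {R : realType}.
Implicit Types (alpha : R) (I J p q z : quat R) (f : quat R -> quat R).
Implicit Types (xy uv : R * R).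

Local Notation T := (caratheodory_type
  ((@lebesgue_measure R \x @lebesgue_measure R)%E^*)%mu).
Local Notation mu := (@lebesgue2 R).

Lemma measurable_gauss2 alpha xy :
  measurable_fun (setT : set T) (gauss2 alpha xy : T -> R).
Proof.
apply: measurable_lebesgue2; rewrite /gauss2.
have m1 := @measurable_fst _ _ (measurableTypeR R) (measurableTypeR R).
have m2 := @measurable_snd _ _ (measurableTypeR R) (measurableTypeR R).
have mc (r : R) := @measurable_cst _ _ (measurableTypeR R * measurableTypeR R)%type
  (measurableTypeR R) setT r.
have s1 := measurable_funX 2 (measurable_funB m1 (mc xy.1)).
have s2 := measurable_funX 2 (measurable_funB m2 (mc xy.2)).
have s := measurable_funN (measurable_funM (mc alpha) (measurable_funD s1 s2)).
exact: (measurableT_comp (@measurable_expR R) s).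
Qed.

Lemma abs_coord_le_qnorm p :
  [/\ `|q0 p| <= qnorm p, `|q1 p| <= qnorm p, `|q2 p| <= qnorm p & `|q3 p| <= qnorm p].
Proof.
have sq (a : R) : a ^+ 2 <= qnorm p ^+ 2 -> `|a| <= qnorm p.
  by rewrite -real_normK ?num_real// ler_pXn2r ?nnegrE ?sqrtr_ge0.
have s0 := sqr_ge0 (q0 p); have s1 := sqr_ge0 (q1 p).
have s2 := sqr_ge0 (q2 p); have s3 := sqr_ge0 (q3 p).
by split; apply: sq; rewrite sqr_qnorm /qdot -!expr2; lra.
Qed.

Lemma measurable_qnorm I f : slice_measurable I f ->
  measurable_fun (setT : set T) (fun uv : T => qnorm (f (slice_pt I uv))).
Proof.
move=> [m0 m1 m2 m3].
have s0 := measurable_funM m0 m0; have s1 := measurable_funM m1 m1.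
have s2 := measurable_funM m2 m2; have s3 := measurable_funM m3 m3.
have s := measurable_funD (measurable_funD (measurable_funD s0 s1) s2) s3.
have msqrt : measurable_fun (setT : set R) (@Num.sqrt R).
  by apply: continuous_measurable_fun; exact: sqrt_continuous.
exact: (measurableT_comp msqrt s).
Qed.

(** The assumed integrand is a positive constant [C] times the Gaussian times [|f|]; dividing by [C]
    gives an integrable bound for every coordinate of the Gaussian times [f]. *)
Lemma gauss_slice_integrable alpha I xy f : 0 < alpha -> imag_unit I ->
  slice_measurable I f ->
  (slice_eintegral I (fun z =>
       (fock_weight alpha z *
         (qnorm (fock_kernel alpha z (slice_pt I xy)) ^+ 2 * qnorm (f z)))%:E) < +oo)%E ->
  qintegrable mu (fun uv : T => gauss2 alpha xy uv *: f (slice_pt I uv)).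
Proof.
move=> a0 II mf fi.
pose C := alpha / pi * expR (alpha * (xy.1 ^+ 2 + xy.2 ^+ 2)).
have C0 : 0 < C by rewrite mulr_gt0 ?expR_gt0// divr_gt0// pi_gt0.
have mg := measurable_gauss2 alpha xy.
have mn := measurable_qnorm mf.
have iC : mu.-integrable setT
    (EFin \o (fun uv : T => C * (gauss2 alpha xy uv * qnorm (f (slice_pt I uv))))).
  apply/integrableP; split.
    apply/measurable_EFinP.
    exact: (measurable_funM (measurable_cst C) (measurable_funM mg mn)).
  move: fi; rewrite /slice_eintegral; congr (_ < _)%E.
  apply: eq_integral => uv _.
  rewrite /= normrM (gtr0_norm C0) ger0_norm ?mulr_ge0 ?expR_ge0 ?sqrtr_ge0//.
  by rewrite mulrA fock_weight_kernel// mulrA.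
have i1 : mu.-integrable setT
    (EFin \o (fun uv : T => gauss2 alpha xy uv * qnorm (f (slice_pt I uv)))).
  have := integrableZl measurableT C^-1 iC.
  apply: eq_integrable => // uv _ /=.
  by rewrite -EFinM mulKf ?gt_eqF.
have bound (c : quat R -> R) : (forall p, `|c p| <= qnorm p) ->
    measurable_fun (setT : set T) (slice_coord c I f) ->
    mu.-integrable setT (EFin \o (fun uv : T => gauss2 alpha xy uv * c (f (slice_pt I uv)))).
  move=> cn mc; apply: (le_integrable measurableT _ _ i1).
    by apply/measurable_EFinP; exact: (measurable_funM mg mc).
  move=> uv _ /=; rewrite lee_fin !normrM ler_wpM2l//.
  by rewrite (le_trans (cn _))// ler_norm.
by case: mf => [m0 m1 m2 m3]; split; apply: bound => // p; have [] := abs_coord_le_qnorm p.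
Qed.

Lemma qintegral_reflect2 (h : T -> quat R) : qintegrable mu h ->
  qintegral mu (fun uv => h (reflect2 uv)) = qintegral mu h.
Proof.
by case=> i0 i1 i2 i3; apply: quatP;
  [exact: (Rintegral_lebesgue2_reflect2 i0) | exact: (Rintegral_lebesgue2_reflect2 i1)
  |exact: (Rintegral_lebesgue2_reflect2 i2) | exact: (Rintegral_lebesgue2_reflect2 i3)].
Qed.

(** Conjugation is an isometry: [|w - z^bar| = |w^bar - z|]. *)
Lemma gauss2_reflect2 alpha xy uv :
  gauss2 alpha (reflect2 xy) uv = gauss2 alpha xy (reflect2 uv).
Proof. by rewrite /gauss2 /=; congr expR; ring. Qed.

(** The planar Berezin transform of an [H]-valued function; applied to [f0] and [f1] it yields the
    slice components of the transform of [f]. *)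
Definition berezin2 alpha (h : R -> R -> quat R) (x y : R) : quat R :=
  (alpha / pi) *: qintegral mu (fun uv : T => gauss2 alpha (x, y) uv *: h uv.1 uv.2).

Lemma berezin2_even alpha (h : R -> R -> quat R) (x y : R) :
  (forall x y, qintegrable mu (fun uv : T => gauss2 alpha (x, y) uv *: h uv.1 uv.2)) ->
  (forall u v, h u (- v) = h u v) ->
  berezin2 alpha h x (- y) = berezin2 alpha h x y.
Proof.
move=> ih hN; rewrite /berezin2 -(qintegral_reflect2 (ih x y)).
rewrite (_ : (fun uv : T => gauss2 alpha (x, - y) uv *: _) =
  (fun uv : T => gauss2 alpha (x, y) (reflect2 uv) *:
    h (reflect2 uv).1 (reflect2 uv).2))//.
by apply/funext => uv; rewrite hN -gauss2_reflect2.
Qed.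

Lemma berezin2_odd alpha (h : R -> R -> quat R) (x y : R) :
  (forall x y, qintegrable mu (fun uv : T => gauss2 alpha (x, y) uv *: h uv.1 uv.2)) ->
  (forall u v, h u (- v) = - h u v) ->
  berezin2 alpha h x (- y) = - berezin2 alpha h x y.
Proof.
move=> ih hN; rewrite /berezin2 -(qintegral_reflect2 (ih x y)).
(* After the substitution [v |-> - v], the reflection passes from the Gaussian to the point
   [(x, y)], and oddness of [h] leaves the factor [-1]. *)
rewrite (_ : (fun uv : T => gauss2 alpha (x, y) (reflect2 uv) *: _) =
  (fun uv : T => -1 *: (gauss2 alpha (x, - y) uv *: h uv.1 uv.2))).
  by rewrite (qintegralZ _ (ih x (- y))).2 scaleN1r scalerN opprK.
by apply/funext => uv; rewrite hN -gauss2_reflect2 scaleN1r scalerN.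
Qed.

End GaussianIntegrals.

(** * Slice components and the splitting of [H] along [C_I] *)

Section SliceComponents.
Context {R : realType}.
Implicit Types (alpha : R) (I J p q z : quat R) (f : quat R -> quat R).

Local Notation T := (caratheodory_type
  ((@lebesgue_measure R \x @lebesgue_measure R)%E^*)%mu).
Local Notation mu := (@lebesgue2 R).

Lemma scaler_swap (V : lmodType R) (a b : R) (v : V) : a *: (b *: v) = b *: (a *: v).
Proof. by rewrite !scalerA mulrC. Qed.

(** A concrete imaginary unit: integrability of [f0] and [f1] is read off from [f] on the single
    plane through it. *)
Definition qi : quat R := Quat 0 1 0 0.

Lemma imag_unit_qi : imag_unit qi.
Proof. by apply/imag_unitP; rewrite /= !expr2; split=> //; ring. Qed.

Lemma qnorm_pureZ I (y : R) : imag_unit I -> qnorm (y *: I) = `|y|.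
Proof.
move=> /imag_unitP[I0 I1]; rewrite /qnorm -sqrtr_sqr; congr Num.sqrt.
by rewrite /qdot !quatE I0 -[RHS]mulr1 -I1; ring.
Qed.

(** A nonreal [z] is [x + y I] for exactly two triples, [(x, y, I)] and [(x, - y, - I)]. The
    function is defined through the one with [y = |Im z| > 0], and the parities make the other give
    the same value. *)
Lemma slice_components_ex (b0 b1 : R -> R -> quat R) :
  (forall x y, b0 x (- y) = b0 x y) -> (forall x y, b1 x (- y) = - b1 x y) ->
  exists g, slice_components g b0 b1.
Proof.
move=> b0N b1N.
pose im z := z - (q0 z)%:A.
(* At real [z] the junk value [0^-1 = 0] removes the second term, as it should
   because [b1 x 0 = 0]. *)
exists (fun z => b0 (q0 z) (qnorm (im z)) +
  ((qnorm (im z))^-1 *: im z) * b1 (q0 z) (qnorm (im z))).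
split=> // x y I II.
have -> : im (slice_pt I (x, y)) = y *: I.
  by rewrite /im q0_slice_pt// /slice_pt /= addrC addKr.
rewrite q0_slice_pt// qnorm_pureZ// scalerA.
case: (ltrgt0P y) => [y0|y0|->].
- by rewrite mulVf ?gt_eqF// scale1r.
(* For [y < 0] the normalized imaginary part is [- I], and its sign cancels that of [b1]. *)
- by rewrite b0N b1N invrN mulNr mulVf ?lt_eqF// scaleN1r mulNr mulrN opprK.
- have b10 : b1 x 0 = 0.
    have h := b1N x 0; rewrite oppr0 in h.
    by apply: quatP; [move: (congr1 (@q0 R) h)|move: (congr1 (@q1 R) h)
      |move: (congr1 (@q2 R) h)|move: (congr1 (@q3 R) h)]; rewrite !quatE /= => ?; lra.
  by rewrite b10 !mulr0.
Qed.

Lemma slice_component0E f (f0 f1 : R -> R -> quat R) I (x y : R) :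
  slice_components f f0 f1 -> imag_unit I ->
  f0 x y = 2^-1 *: (f (slice_pt I (x, y)) + f (slice_pt (- I) (x, y))).
Proof.
move=> [_ _ fE] II; rewrite (fE _ _ _ II) (fE _ _ _ (imag_unitN II)).
by apply: quatP; rewrite !quatE; field.
Qed.

(** The values at [- I] and [I] differ by [-2 I f1], and left multiplication by [I] turns this into
    [2 f1]. *)
Lemma slice_component1E f (f0 f1 : R -> R -> quat R) I (x y : R) :
  slice_components f f0 f1 -> imag_unit I ->
  f1 x y = 2^-1 *: (I * f (slice_pt (- I) (x, y)) + - I * f (slice_pt I (x, y))).
Proof.
move=> [_ _ fE] II; rewrite (fE _ _ _ II) (fE _ _ _ (imag_unitN II)).
rewrite !mulrDr !mulrA !(mulrN, mulNr) II !mulN1r !opprK.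
by apply: quatP; rewrite !quatE; field.
Qed.

Lemma qreal_coordP p : qreal p <-> [/\ q1 p = 0, q2 p = 0 & q3 p = 0].
Proof.
split=> [[a ->]|[p1 p2 p3]]; first by split; rewrite !quatE /= mulr0.
by exists (q0 p); apply: quatP; rewrite !quatE /= ?mulr1 ?mulr0.
Qed.

(** For purely imaginary quaternions [I J + J I] is the real number [-2 <I, J>]. *)
Lemma anticomm_imag_unit I J : imag_unit I -> imag_unit J -> qorth J I ->
  J * I = - (I * J).
Proof.
move=> /imag_unitP[I0 _] /imag_unitP[J0 _]; rewrite /qorth /qdot I0 J0 => JI.
by apply: quatP; rewrite !quatE I0 J0; lra.
Qed.

Lemma slice_plane_comm I p : slice_plane I p -> I * p = p * I.
Proof.
move=> [[a b] _ <-]; rewrite /slice_pt /=.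
by rewrite mulrDl mulrDr -!qscaleAr -!scalerAl mulr1 mul1r.
Qed.

(* Conjugation by [I] fixes [C_I] and is [-1] on [C_I J]. *)
Lemma slice_splitting I J p q : imag_unit I -> imag_unit J -> qorth J I ->
  slice_plane I p -> slice_plane I q ->
  p = 2^-1 *: ((p + q * J) + - I * (p + q * J) * I) /\
  q = 2^-1 *: (((p + q * J) + I * (p + q * J) * I) * - J).
Proof.
move=> II JJ JI /slice_plane_comm Ip /slice_plane_comm Iq.
have AC := anticomm_imag_unit II JJ JI.
have conj : I * (p + q * J) * I = - p + q * J.
  rewrite mulrDr mulrDl Ip -mulrA II mulrN1; congr (_ + _).
  by rewrite mulrA Iq -!mulrA AC mulrN mulrA II mulN1r opprK.
split; first by rewrite !mulNr conj; apply: quatP; rewrite !quatE; field.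
rewrite conj addrACA subrr add0r -mulrDl -mulrA mulrN JJ opprK mulr1.
by apply: quatP; rewrite !quatE; field.
Qed.

End SliceComponents.

(** * The Berezin transform assembled from its slice components *)

Theorem theorem4p3 (R : realType) (alpha : R) (f : quat R -> quat R)
  (alpha_gt0 : 0 < alpha)
  (f_slice : slice_function f)
  (f_meas : forall I : quat R, imag_unit I -> slice_measurable I f)
  (f_int : forall I a : quat R, imag_unit I -> slice_plane I a ->
    (slice_eintegral I (fun z =>
       (fock_weight alpha z *
         (qnorm (fock_kernel alpha z a) ^+ 2 * qnorm (f z)))%:E) < +oo)%E) :
  (exists Bf : quat R -> quat R, is_berezin_transform alpha f Bf) /\
  forall Bf : quat R -> quat R, is_berezin_transform alpha f Bf ->
    [/\ forall I z : quat R, imag_unit I -> slice_plane I z ->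
          slice_integrable I (gauss_integrand alpha f z) /\
          Bf z = classical_berezin alpha I f z,
        slice_function Bf,
        forall (I J : quat R) (F G : quat R -> quat R),
          imag_unit I -> imag_unit J -> qorth J I ->
          (forall z, slice_plane I z -> slice_plane I (F z)) ->
          (forall z, slice_plane I z -> slice_plane I (G z)) ->
          (forall z, slice_plane I z -> f z = F z + G z * J) ->
          forall z, slice_plane I z ->
            [/\ slice_integrable I (gauss_integrand alpha F z),
                slice_integrable I (gauss_integrand alpha G z)
              & Bf z = classical_berezin alpha I F z +
                       classical_berezin alpha I G z * J]
      & slice_intrinsic f -> slice_intrinsic Bf].
Proof.
pose T := caratheodory_type
  ((@lebesgue_measure R \x @lebesgue_measure R)%E^*)%mu.
pose mu := @lebesgue2 R.
(* The integrability hypothesis is taken at [a = z], the point where the transform is evaluated. *)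
have gi I xy : imag_unit I ->
    qintegrable mu (fun uv : T => gauss2 alpha xy uv *: f (slice_pt I uv)).
  move=> II; have pI : slice_plane I (slice_pt I xy) by exists xy.
  exact: gauss_slice_integrable alpha_gt0 II (f_meas I II) (f_int I _ II pI).
have slice_gaussE I xy (F : quat R -> quat R) : imag_unit I ->
    (fun uv : T => gauss_integrand alpha F (slice_pt I xy) (slice_pt I uv)) =
    (fun uv : T => gauss2 alpha xy uv *: F (slice_pt I uv)).
  by move=> II; apply/funext => uv; rewrite gauss_integrand_slice_pt.
have slice_intE I xy (F : quat R -> quat R) : imag_unit I ->
    slice_integrable I (gauss_integrand alpha F (slice_pt I xy)) <->
    qintegrable mu (fun uv : T => gauss2 alpha xy uv *: F (slice_pt I uv)).
  by move=> II; rewrite -slice_gaussE.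
have classicalE I xy (F : quat R -> quat R) : imag_unit I ->
    classical_berezin alpha I F (slice_pt I xy) =
    (alpha / pi) *: qintegral mu (fun uv : T => gauss2 alpha xy uv *: F (slice_pt I uv)).
  by move=> II; rewrite -slice_gaussE.
have berezinE I xy : imag_unit I ->
    slice_integrable I (berezin_integrand alpha f (slice_pt I xy)) /\
    slice_integral I (berezin_integrand alpha f (slice_pt I xy)) =
    classical_berezin alpha I f (slice_pt I xy).
  move=> II; rewrite classicalE//.
  have [ib eb] := qintegralZ (alpha / pi) (gi I xy II).
  rewrite -eb.
  have bE : (fun uv : T => berezin_integrand alpha f (slice_pt I xy) (slice_pt I uv)) =
      (fun uv : T => (alpha / pi) *: (gauss2 alpha xy uv *: f (slice_pt I uv))).
    by apply/funext => uv; rewrite berezin_integrand_slice_pt.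
  by rewrite -bE in ib *.
have comp f0 f1 : slice_components f f0 f1 ->
    (forall x y, qintegrable mu (fun uv : T => gauss2 alpha (x, y) uv *: f0 uv.1 uv.2)) /\
    (forall x y, qintegrable mu (fun uv : T => gauss2 alpha (x, y) uv *: f1 uv.1 uv.2)).
  (* The planes of [qi] and [- qi] coincide as sets but are parametrized with opposite signs of [v];
     both parametrizations enter the formulas for [f0] and [f1]. *)
  move=> fc; have Hi := @imag_unit_qi R; have HNi := imag_unitN Hi.
  split=> x y; have gp := gi _ (x, y) Hi; have gm := gi _ (x, y) HNi.
    have [+ _] := qintegralZ 2^-1 (qintegrableD gp gm).
    apply: eq_qintegrable => -[u v].
    by rewrite (slice_component0E _ _ fc Hi) -scalerDr (scaler_swap _ 2^-1).
  have [gm' _] := qintegralMl (@qi R) gm; have [gp' _] := qintegralMl (- @qi R) gp.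
  have [+ _] := qintegralZ 2^-1 (qintegrableD gm' gp').
  apply: eq_qintegrable => -[u v].
  by rewrite (slice_component1E _ _ fc Hi) -!qscaleAr -scalerDr (scaler_swap _ 2^-1).
have classical_comp f0 f1 I x y : slice_components f f0 f1 -> imag_unit I ->
    classical_berezin alpha I f (slice_pt I (x, y)) =
    berezin2 alpha f0 x y + I * berezin2 alpha f1 x y.
  move=> fc II; have [i0 i1] := comp _ _ fc; rewrite classicalE// /berezin2.
  have [i1' e1] := qintegralMl I (i1 x y).
  rewrite -qscaleAr -scalerDr -e1 -qintegralD//.
  congr (_ *: qintegral _ _); apply/funext => -[u v]; have [_ _ fE] := fc.
  by rewrite fE// scalerDr qscaleAr.
have Bcomp f0 f1 : slice_components f f0 f1 ->
    (forall x y, berezin2 alpha f0 x (- y) = berezin2 alpha f0 x y) /\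
    (forall x y, berezin2 alpha f1 x (- y) = - berezin2 alpha f1 x y).
  move=> fc; have [i0 i1] := comp _ _ fc; have [f0N f1N _] := fc.
  by split=> x y; [exact: berezin2_even | exact: berezin2_odd].
split.
  (* Existence: the integrals over different planes through a point, and over both parametrizations
     of one plane, must agree. Gluing from the transformed components ensures this, since the
     integral depends on [I] only through [b0 + I * b1]. *)
  have [f0 [f1 fc]] := f_slice; have [b0N b1N] := Bcomp _ _ fc.
  have [Bf [_ _ BfE]] := slice_components_ex b0N b1N.
  exists Bf => I z II [[x y] _ <-]; have [ib ->] := berezinE I (x, y) II.
  by split=> //; rewrite BfE// (classical_comp _ _ _ _ _ fc).
move=> Bf Bfb.
have BfE I xy : imag_unit I -> Bf (slice_pt I xy) = classical_berezin alpha I f (slice_pt I xy).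
  move=> II; have [|_ ->] := Bfb I (slice_pt I xy) II; first by exists xy.
  by have [] := berezinE I xy II.
have Bfc f0 f1 : slice_components f f0 f1 ->
    slice_components Bf (berezin2 alpha f0) (berezin2 alpha f1).
  move=> fc; have [b0N b1N] := Bcomp _ _ fc; split=> // x y I II.
  by rewrite BfE// (classical_comp _ _ _ _ _ fc).
split.
- move=> I z II [xy _ <-]; split; last exact: BfE.
  by apply/slice_intE => //; exact: gi.
- by have [f0 [f1 fc]] := f_slice; exists (berezin2 alpha f0), (berezin2 alpha f1); exact: Bfc.
- move=> I J F G II JJ JI FI GI fE z [xy _ <-].
  have pI uv : slice_plane I (slice_pt I uv) by exists uv.
  (* [F] and [G] are obtained from [f] by multiplications with fixed quaternions, so their Gaussian
     integrability is inherited from that of [f]. *)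
  have split_uv uv := slice_splitting II JJ JI (FI _ (pI uv)) (GI _ (pI uv)).
  have g := gi I xy II.
  have [gN _] := qintegralMl (- I) g; have [gNI _] := qintegralMr I gN.
  have [gP _] := qintegralMl I g; have [gPI _] := qintegralMr I gP.
  have iF : qintegrable mu (fun uv : T => gauss2 alpha xy uv *: F (slice_pt I uv)).
    have [+ _] := qintegralZ 2^-1 (qintegrableD g gNI).
    apply: eq_qintegrable => uv; rewrite (split_uv uv).1 -fE//.
    by rewrite -qscaleAr -scalerAl -scalerDr (scaler_swap _ 2^-1).
  have iG : qintegrable mu (fun uv : T => gauss2 alpha xy uv *: G (slice_pt I uv)).
    have [iJ _] := qintegralMr (- J) (qintegrableD g gPI).
    have [+ _] := qintegralZ 2^-1 iJ.
    apply: eq_qintegrable => uv; rewrite (split_uv uv).2 -fE//.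
    by rewrite -qscaleAr -scalerAl -scalerDr -scalerAl (scaler_swap _ 2^-1).
  split; [exact/slice_intE | exact/slice_intE |].
  have [iGJ eGJ] := qintegralMr J iG.
  rewrite BfE// !classicalE// -scalerAl -eGJ -scalerDr -qintegralD//.
  congr (_ *: qintegral _ _); apply/funext => uv.
  by rewrite fE// scalerDr scalerAl.
- move=> [f0 [f1 [fc fr]]].
  exists (berezin2 alpha f0), (berezin2 alpha f1); split; first exact: Bfc.
  have real h : (forall x y, qreal (h x y)) -> forall x y, qreal (berezin2 alpha h x y).
    move=> hr x y; apply/qreal_coordP.
    (* The three imaginary coordinates of the integrand vanish identically. Writing [0] as
       [0 * mu(T)] presents it as the integral of the constant [0]. *)
    by split; rewrite !quatE /qintegral /= [X in _ * X](_ : _ = 0) ?mulr0//;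
      rewrite -[RHS](mul0r (fine (mu setT))) -Rintegral_cst//; apply: eq_Rintegral => uv _;
      have /qreal_coordP[h1 h2 h3] := hr uv.1 uv.2; rewrite ?h1 ?h2 ?h3 mulr0.
  by move=> x y; split; apply: real => u v; have [] := fr u v.
Qed.
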